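(* Let $d\ge 1$ and $n\ge d+2$. Suppose ${\bf A}={\bf D}{\bf P}$, with ${\bf D}$ an invertible diagonal $N\times N$ matrix and ${\bf P}$ a permutation matrix, is a linear automorphism of $M_{d,n}$. Then ${\bf A}$ is induced by a vertex relabeling (i.e., ${\bf P}$ maps each $e_{\{i,j\}}$ to $e_{\{\sigma(i),\sigma(j)\}}$ for some permutation $\sigma$ of $\{1,\dots,n\}$) and ${\bf A}$ has uniform scale (i.e., ${\bf D}$ is a scalar multiple of the identity).
   Context: Let $N=\binom{n}{2}$ and index coordinates of $\mathbb C^N$ by the edges $\{i,j\}$ of $K_n$, with coordinate vectors $e_{\{i,j\}}$. For a complex configuration ${\bf p}=({\bf p}_1,\dots,{\bf p}_n)$ in $\mathbb C^d$, $m({\bf p})\in\mathbb C^N$ has coordinates $m_{ij}({\bf p})=\sum_{k=1}^d({\bf p}_i^k-{\bf p}_j^k)^2$ (no conjugation); $M_{d,n}$ is the image of $m$ over all complex configurations. A linear automorphism of $M_{d,n}$ is a non-singular $N\times N$ complex matrix mapping $M_{d,n}$ bijectively onto itself. *)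

(* Defs.v *)
(* Complex numbers: C := R[i] (mathcomp-real-closed) for
   R : realType (a complete archimedean ordered field, i.e. the reals). *)
From mathcomp Require Import all_boot all_algebra perm.
From mathcomp Require Export reals complex.
Set Implicit Arguments. Unset Strict Implicit. Unset Printing Implicit Defensive.
Import GRing.Theory.
Local Open Scope ring_scope.

(* The edges {i,j} of K_n: two-element subsets of 'I_n. They index the
   N = binom(n,2) coordinates of C^N. *)
Definition edge (n : nat) := {A : {set 'I_n} | #|A| == 2%N}.

Section Defs.
Variable C : comNzRingType.
Variables d n : nat.

Definition evec := edge n -> C.
Definition emat := edge n -> edge n -> C.

Definition mapply (A : emat) (v : evec) : evec :=
  fun e => \sum_(f : edge n) A e f * v f.
Definition mmul (A B : emat) : emat :=
  fun e g => \sum_(f : edge n) A e f * B f g.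
Definition midm : emat := fun e f => (e == f)%:R.
Definition unitv (g : edge n) : evec := fun e => (e == g)%:R.

Definition diagm (delta : edge n -> C) : emat :=
  fun e f => if e == f then delta e else 0.
(* permutation matrix of pi : it maps e_f to e_(pi f) *)
Definition permm (pi : {perm edge n}) : emat :=
  fun e f => (e == pi f)%:R.

Definition nonsingular (A : emat) : Prop :=
  exists B : emat, mmul A B = midm /\ mmul B A = midm.

(* complex configurations of n points in C^d and the measurement map m:
   m_{ij}(p) = sum_k (p_i^k - p_j^k)^2 (no conjugation).  For the edge
   e = {i,j} the double sum over i,j in e with i < j has exactly one term. *)
Definition config := 'I_n -> 'I_d -> C.
Definition meas (p : config) : evec :=
  fun e => \sum_(i in val e) \sum_(j in val e | (i < j)%N)
             \sum_(k < d) (p i k - p j k) ^+ 2.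

Definition Mdn (x : evec) : Prop := exists p : config, x = meas p.

Definition lin_auto (A : emat) : Prop :=
  nonsingular A /\
  (forall x, Mdn x -> Mdn (mapply A x)) /\
  (forall y, Mdn y -> exists x, Mdn x /\ mapply A x = y).

End Defs.

(* Main.v *)
(* Taking Gram matrices with respect to vertex 0 identifies M_{d,n} with the
   symmetric matrices of rank at most d.  For d + 2 <= n, the smaller variety
   M_{d-1,n} can be read off M_{d,n} in terms of lines: a point x of M_{d,n} lies
   in M_{d-1,n} iff the directions y with x + t y in M_{d,n} for all t span the
   whole space.  Indeed, if x has rank d - 1, all measurements of configurations
   on a line are such directions; if x has rank d, all such y are killed by the
   form y |-> v y v^T, for v in the kernel of x.  Hence a linear bijection
   preserving M_{d,n} preserves M_{1,n}.  There, a nonempty support contains a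
   cut of K_n, so the supports of size n - 1 are the stars; therefore P permutes
   the stars.  The image of the indicator of a vertex comes from a configuration
   that agrees on all the other vertices, so D is constant on each star. *)
Require Import Defs.
From mathcomp Require Import all_boot all_order all_algebra perm.
From mathcomp Require Import boolp reals complex ring zify.
Set Implicit Arguments. Unset Strict Implicit. Unset Printing Implicit Defensive.
Import Order.TTheory GRing.Theory Num.Theory.
Local Open Scope ring_scope.

(** * Symmetric matrices: factorization and lines of bounded rank *)

(** Polarization: if the form vanishes at [e_i], [e_j] and [e_i + e_j], then [2 S_ij = 0]. *)
Lemma symmetric_anisotropic (F : numFieldType) m (S : 'M[F]_m) :
  S^T = S -> S != 0 -> exists u : 'rV_m, (u *m S *m u^T) 0 0 != 0.
Proof.
move=> symS; apply: contraNP => noU.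
have q0 (u : 'rV_m) : (u *m S *m u^T) 0 0 = 0.
  by apply/eqP; apply: contraPT noU => qu noU; apply: noU; exists u.
have E i j : ((delta_mx 0 i : 'rV_m) *m S *m (delta_mx 0 j : 'rV_m)^T) 0 0 = S i j.
  by rewrite -rowE trmx_delta -colE !mxE.
have addE (B B' : 'M[F]_1) : (B + B') 0 0 = B 0 0 + B' 0 0 by rewrite mxE.
have S0 i : S i i = 0 by rewrite -E q0.
apply/eqP/matrixP=> i j; rewrite mxE.
have := q0 (delta_mx 0 i + delta_mx 0 j).
rewrite linearD /= !mulmxDl !mulmxDr !(addE, E) !S0.
have -> : S j i = S i j by rewrite -[in LHS]symS mxE.
rewrite add0r addr0 => /eqP.
by rewrite -mulr2n mulrn_eq0 /= => /eqP.
Qed.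

(** Rank-one summands are split off one at a time. With [a = u S u^T] nonzero,
    [S - a^-1 (u S)^T (u S)] kills [u^T], which [S] does not, so the rank drops; a square root of
    [a^-1] supplies the new column of [E]. *)
Lemma symmetric_factor (F : numClosedFieldType) m r (S : 'M[F]_m) :
  S^T = S -> (\rank S <= r)%N -> exists E : 'M_(m, r), S = E *m E^T.
Proof.
elim: r S => [|r IHr] S symS rkS.
  exists 0; apply/eqP; rewrite mul0mx -mxrank_eq0; lia.
have [->|S_neq0] := eqVneq S 0; first by exists 0; rewrite mul0mx.
have [u] := symmetric_anisotropic symS S_neq0; set a := _ 0 0 => a_neq0.
pose w := u *m S.
have wT : w^T = S *m u^T by rewrite trmx_mul symS.
have wu : w *m u^T = a%:M by rewrite [LHS]mx11_scalar.
pose S' := S - a^-1 *: (w^T *m w).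
have symS' : S'^T = S' by rewrite linearB linearZ /= trmx_mul trmxK symS.
have S'u : S' *m u^T = 0.
  rewrite mulmxBl -scalemxAl -mulmxA wu mul_mx_scalar scalerA mulVf // scale1r.
  by rewrite wT subrr.
have sub : (S' <= S)%MS.
  by rewrite addmx_sub // -scaleNr scalemx_sub // mulmx_sub // submxMl.
have [le_rk eq_rk] := mxrank_leqif_sup sub.
have lt_rk : (\rank S' < \rank S)%N.
  rewrite ltn_neqAle le_rk eq_rk andbT; apply/negP=> /submxP[B SB].
  move/eqP: a_neq0; apply; rewrite /a -mulmxA SB -mulmxA S'u.
  by rewrite !mulmx0 mxE.
have [|E' S'E] := IHr S' symS'; first lia.
pose E := row_mx (sqrtC a^-1 *: w^T) E'.
suff SE : S = E *m E^T by exists E.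
rewrite tr_row_mx mul_row_col -S'E linearZ /= trmxK -scalemxAr -scalemxAl scalerA.
by rewrite -expr2 sqrtCK addrC subrK.
Qed.

(* Dividing the last row of [G + tH], compressed to the complement of the kernel
   of [G] plus the line [v], by [t] leaves a matrix polynomial in [t] that is
   singular for [t != 0], hence at [t = 0], where its determinant is
   [v H v^T]. *)
Lemma rank_line_kernel (F : numClosedFieldType) m r (G H : 'M[F]_m) (v : 'rV_m) :
  G^T = G -> \rank G = r -> (forall t, \rank (G + t *: H)%R <= r)%N ->
  v *m G = 0 -> v *m H *m v^T = 0.
Proof.
move=> symG rkG rkGH vG.
have [|E GE] := @symmetric_factor F m r G symG; first by rewrite rkG.
have fullE : row_full E.
  rewrite /row_full eqn_leq rank_leq_col -{1}rkG GE.
  exact: mxrankM_maxl.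
pose U := pinvmx E.
have UE : U *m E = 1%:M by rewrite mulVpmx.
have UG : U *m G *m U^T = 1%:M.
  by rewrite GE mulmxA UE mul1mx -trmx_mul UE trmx1.
have Gv : G *m v^T = 0 by rewrite -[G]symG -trmx_mul vG trmx0.
pose A := U *m H *m U^T; pose b := U *m H *m v^T.
pose b' := v *m H *m U^T; pose c := v *m H *m v^T.
pose M : 'M[{poly F}]_(r + 1) :=
  block_mx (1%:M + 'X *: map_mx polyC A) ('X *: map_mx polyC b)
           (map_mx polyC b') (map_mx polyC c).
have evM t : map_mx (horner_eval t) M =
    block_mx (1%:M + t *: A) (t *: b) b' c.
  rewrite map_block_mx map_mxD !map_mxZ map_mx1 /= -!map_mx_comp.
  have ev n1 n2 (B : 'M[F]_(n1, n2)) : map_mx (horner_eval t \o polyC) B = B.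
    by apply/matrixP=> i j; rewrite !mxE /= /horner_eval hornerC.
  by rewrite !ev /horner_eval hornerX.
have detM t : t != 0 -> (\det M).[t] = 0.
  move=> t_neq0.
  have -> : (\det M).[t] = \det (map_mx (horner_eval t) M) by rewrite det_map_mx.
  rewrite evM; set B := block_mx _ _ _ _.
  pose W := col_mx U v.
  have WGW : W *m (G + t *: H) *m W^T =
      block_mx 1%:M 0 0 t%:M *m B.
    rewrite tr_col_mx mul_col_mx mul_col_row !mulmxDr !mulmxDl -!scalemxAr.
    rewrite -!scalemxAl UG vG !mul0mx -[U *m G *m v^T]mulmxA Gv mulmx0 !add0r.
    rewrite /B mulmx_block !mul1mx !mul0mx !add0r !addr0.
    by rewrite !mul_scalar_mx.
  have : \det (W *m (G + t *: H) *m W^T) = 0.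
    apply/eqP/negPn; rewrite -unitfE -unitmxE -row_free_unit -row_leq_rank.
    rewrite -ltnNge; apply: (@leq_ltn_trans r); last by rewrite addn1.
    apply: leq_trans (rkGH t).
    exact: leq_trans (mxrankM_maxl _ _) (mxrankM_maxr _ _).
  rewrite WGW det_mulmx det_ublock det1 mul1r det_scalar1 => /eqP.
  by rewrite mulf_eq0 (negPf t_neq0) => /eqP.
(* The factor ['X] supplies the root 0 excluded in [detM]; a nonzero polynomial cannot vanish at as
   many naturals as its size. *)
have detM0 : 'X * \det M = 0.
  apply/eqP; apply/negPn/negP => nz.
  have := @max_poly_roots _ _ (map (fun i => i%:R) (iota 0 (size ('X * \det M)))) nz.
  rewrite size_map size_iota ltnn => contra; apply: notF; apply: contra.
    apply/allP=> t _; rewrite rootE hornerM hornerX.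
    by have [->|/detM->] := eqVneq t 0; rewrite ?mul0r ?mulr0.
  by rewrite map_inj_uniq ?iota_uniq // => i j /eqP; rewrite eqr_nat => /eqP.
have /(congr1 (horner_eval 0)) : \det M = 0.
  by apply/eqP; move/eqP: detM0; rewrite mulf_eq0 polyX_eq0.
rewrite -det_map_mx evM !scale0r addr0 det_lblock det1 mul1r /horner_eval horner0.
by move=> dc; rewrite [LHS]mx11_scalar -det_mx11 dc raddf0.
Qed.

(** * Edges and their measurements *)

Lemma edgeP n (e : edge n) : exists i j : 'I_n, i != j /\ val e = [set i; j].
Proof.
by have /cards2P[i [j [ij eE]]] := valP e; exists i, j.
Qed.

Lemma edge_exists n (i j : 'I_n) : i != j -> {e : edge n | val e = [set i; j]}.
Proof.
move=> ij; have c2 : #|[set i; j]| == 2 by rewrite cards2 ij.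
by exists (Sub [set i; j] c2).
Qed.

Lemma meas_edge (C : comNzRingType) d n (p : config C d n) (e : edge n) i j :
  i != j -> val e = [set i; j] -> meas p e = \sum_k (p i k - p j k) ^+ 2.
Proof.
wlog lt_ij : i j / (i < j)%N => [th ij eE|].
  case: (ltngtP i j) => [lt|gt|/val_inj eq]; first exact: th.
    rewrite (th j i) 1?eq_sym 1?setUC //.
    by apply: eq_bigr => k _; rewrite -sqrrN opprB.
  by rewrite eq eqxx in ij.
move=> ij eE; rewrite /meas eE big_setU1 ?inE //= big_set1.
rewrite [X in _ + X]big1 ?addr0 => [|k]; last first.
  by rewrite !inE => /andP[/orP[]/eqP->]; rewrite ?ltnn // ltnNge ltnW.
rewrite (big_pred1 j) // => k; rewrite !inE.
case: (eqVneq k i) => [->|_] /=; first by rewrite ltnn (negPf ij).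
by case: eqVneq => //= ->.
Qed.

(** * Gram matrices, and the rank read off from directions of lines *)

Section Gram.
Variables (C : numClosedFieldType) (n : nat).
Implicit Types (x y : evec C n.+1) (i j : 'I_n.+1).

(** The default 0 is reached exactly for [i = j], where it is the right squared distance. *)
Definition dist x i j : C := oapp x 0 (insub [set i; j]).

Lemma dist_edge x e i j : val e = [set i; j] -> dist x i j = x e.
Proof. by rewrite /dist => <-; rewrite valK. Qed.

Lemma distxx x i : dist x i i = 0.
Proof. by rewrite /dist insubN //= setUid cards1. Qed.

Lemma dist_sym x i j : dist x i j = dist x j i.
Proof. by rewrite /dist setUC. Qed.

Lemma dist_meas d (p : config C d n.+1) i j :
  dist (meas p) i j = \sum_k (p i k - p j k) ^+ 2.
Proof.
have [<-|ij] := eqVneq i j.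
  by rewrite distxx big1 // => k _; rewrite subrr expr0n.
by have [e eE] := edge_exists ij; rewrite (dist_edge _ eE) (meas_edge _ ij eE).
Qed.

Lemma dist_lin x y t i j :
  dist (fun e => x e + t * y e) i j = dist x i j + t * dist y i j.
Proof. by rewrite /dist; case: insub => //=; rewrite mulr0 addr0. Qed.

(** By the law of cosines, [x = meas p] gives the inner products of the [p_i - p_0]. The row and
    column of vertex 0 vanish, so keeping them does not change the rank. *)
Definition gram x : 'M[C]_n.+1 :=
  \matrix_(i, j) ((dist x i 0 + dist x j 0 - dist x i j) / 2).

Lemma gram_sym x : (gram x)^T = gram x.
Proof. by apply/matrixP=> i j; rewrite !mxE (dist_sym x j i) [_ + dist x j 0]addrC. Qed.

Lemma gram_lin x y t : gram (fun e => x e + t * y e) = gram x + t *: gram y.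
Proof. by apply/matrixP=> i j; rewrite !mxE !dist_lin; field. Qed.

Lemma gram_sum y : gram y = \sum_e y e *: gram (unitv C e).
Proof.
have distE i j : dist y i j = \sum_e y e * dist (unitv C e) i j.
  rewrite /dist; case: insub => [f|] /=; last by rewrite big1 // => e; rewrite mulr0.
  rewrite (bigD1 f) //= /unitv eqxx mulr1 big1 ?addr0 // => e.
  by rewrite eq_sym => /negPf->; rewrite mulr0.
apply/matrixP=> i j; rewrite mxE !distE summxE -big_split -sumrB mulr_suml.
by apply: eq_bigr => e _ /=; rewrite !mxE; field.
Qed.

Lemma gram_meas d (p : config C d n.+1) i j :
  gram (meas p) i j = \sum_k (p i k - p 0 k) * (p j k - p 0 k).
Proof.
rewrite mxE !dist_meas -big_split -sumrB mulr_suml /=.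
by apply: eq_bigr => k _; field.
Qed.

(** A configuration gives a factorization [P P^T] with [d] columns. Conversely, the rows of a
    symmetric factor serve as points, since [x_ij = G_ii + G_jj - 2 G_ij]. *)
Lemma Mdn_gramP d x : Mdn d x <-> (\rank (gram x) <= d)%N.
Proof.
split=> [[p ->]|rk].
  pose P : 'M[C]_(n.+1, d) := \matrix_(i, k) (p i k - p 0 k).
  suff -> : gram (meas p) = P *m P^T.
    exact: leq_trans (mxrankM_maxl _ _) (rank_leq_col _).
  apply/matrixP=> i j; rewrite gram_meas mxE.
  by apply: eq_bigr => k _; rewrite !mxE.
have [E gE] := symmetric_factor (gram_sym x) rk.
exists (fun i k => E i k); apply: funext => e.
have [i [j [ij eE]]] := edgeP e.
rewrite (meas_edge _ ij eE) -(dist_edge x eE).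
have gEE i' j' : gram x i' j' = \sum_k E i' k * E j' k.
  by rewrite gE mxE; apply: eq_bigr => k _; rewrite mxE.
transitivity (gram x i i + gram x j j - 2 * gram x i j).
  by rewrite !mxE !distxx; field.
rewrite !gEE mulr_sumr -big_split -sumrB /=.
by apply: eq_bigr => k _; ring.
Qed.

(** Its measurement is the 0/1 vector of the cut between [A] and its complement. *)
Definition indicator (A : {set 'I_n.+1}) : config C 1 n.+1 :=
  fun i _ => (i \in A)%:R.

Lemma meas_indicator1 i e :
  meas (indicator [set i]) e = (i \in val e)%:R.
Proof.
have [a [b [ab eE]]] := edgeP e.
rewrite (meas_edge _ ab eE) big_ord1 /indicator eE !inE ![i == _]eq_sym.
have : ~~ ((a == i) && (b == i)) by apply: contra ab => /andP[/eqP-> /eqP->].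
by case: (a == i); case: (b == i) => //= _; ring.
Qed.

Lemma meas_indicator2 i j e : i != j ->
  meas (indicator [set i; j]) e =
  (i \in val e)%:R + (j \in val e)%:R - 2 * (val e == [set i; j])%:R.
Proof.
move=> ij; have [a [b [ab eE]]] := edgeP e.
have -> : (val e == [set i; j]) = (i \in val e) && (j \in val e).
  rewrite eq_sym eqEcard (eqP (valP e)) cards2 ij andbT subUset !sub1set.
  by [].
rewrite (meas_edge _ ab eE) big_ord1 /indicator eE !inE ![_ == a]eq_sym ![_ == b]eq_sym.
have : ~~ ((a == i) && (a == j)) by apply: contra ij => /andP[/eqP<- /eqP<-].
have : ~~ ((b == i) && (b == j)) by apply: contra ij => /andP[/eqP<- /eqP<-].
have : ~~ ((a == i) && (b == i)) by apply: contra ab => /andP[/eqP-> /eqP->].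
have : ~~ ((a == j) && (b == j)) by apply: contra ab => /andP[/eqP-> /eqP->].
by case: (a == i); case: (a == j); case: (b == i); case: (b == j) => //= _ _ _ _; ring.
Qed.

(** The cuts of [{i}], [{j}] and [{i,j}] suffice: the first two minus the third is twice the unit
    vector of the edge. *)
Lemma squares_span (L : evec C n.+1) :
  (forall q : config C 1 n.+1, \sum_e L e * meas q e = 0) -> forall e, L e = 0.
Proof.
move=> L0 e; have [i [j [ij eE]]] := edgeP e.
have := L0 (indicator [set i; j]).
under eq_bigr do rewrite meas_indicator2 // mulrBr mulrDr.
rewrite sumrB big_split /=.
under eq_bigr do rewrite -meas_indicator1.
rewrite L0; under eq_bigr do rewrite -meas_indicator1.
rewrite L0 add0r sub0r (bigD1 e) //= eE eqxx big1 => [|f fe].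
  by move/eqP; rewrite addr0 mulr1 oppr_eq0 mulf_eq0 pnatr_eq0 orbF => /eqP.
by rewrite -eE (inj_eq val_inj) (negPf fe) !mulr0.
Qed.

Definition line_dir k x y :=
  forall t, Mdn k (fun e => x e + t * y e).

(** Dual form of spanning: functionals are easy to pull back along a scaled permutation. *)
Definition spanning k x :=
  forall L : evec C n.+1, (forall y, line_dir k x y -> \sum_e L e * y e = 0) ->
  forall e, L e = 0.

(** Appending the coordinate [sqrtC t * q] to [p] realizes [meas p + t * meas q] in one more
    dimension, so every [meas q] is a direction. *)
Lemma Mdn_spanning k x : Mdn k x -> spanning k.+1 x.
Proof.
case=> p ->{x} L L0; apply: squares_span => q; apply: L0 => t.
pose p' i : 'rV_(1 + k) :=
  row_mx (const_mx (sqrtC t * q i 0)) (\row_h p i h).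
suff xE : (fun e => meas p e + t * meas q e) =
    @meas C (1 + k) n.+1 (fun i h => p' i 0 h) by exists (fun i h => p' i 0 h).
apply: funext => e; have [i [j [ij eE]]] := edgeP e.
rewrite !(meas_edge _ ij eE) big_ord1 big_split_ord big_ord1 /=.
rewrite [RHS]addrC /p'; congr (_ + _).
  by apply: eq_bigr => h _; rewrite !row_mxEr !mxE.
by rewrite !row_mxEl !mxE -mulrBr exprMn sqrtCK.
Qed.

(** If the rank were [k.+1], a kernel vector [v] would give the functional [y |-> v (gram y) v^T],
    which kills all directions by [rank_line_kernel] but takes the value [v_i ^+ 2] at the indicator
    of a vertex [i] other than 0. *)
Lemma spanning_Mdn k x : (k.+1 < n)%N ->
  Mdn k.+1 x -> spanning k.+1 x -> Mdn k x.
Proof.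
move=> kn /Mdn_gramP rk1 span; apply/Mdn_gramP; rewrite leqNgt; apply/negP=> rk2.
have rk : \rank (gram x) = k.+1 by lia.
have [v vG [i i0 vi]] : exists2 v : 'rV[C]_n.+1, v *m gram x = 0 &
    exists2 i, i != 0 & v 0 i != 0.
  (* The kernel has dimension [n - k], at least 2, so it is not confined to the line of vertex 0. *)
  have : ~~ (kermx (gram x) <= (delta_mx 0 0 : 'rV[C]_n.+1))%MS.
    apply/negP=> /mxrankS; rewrite mxrank_ker mxrank_delta rk; lia.
  case/rV_subP/existsNP=> v /not_implyP[/sub_kermxP vG vd]; exists v => //.
  apply: contra_notP vd => vd; apply/sub_rVP; exists (v 0 0).
  apply/rowP=> i; rewrite !mxE eqxx /=; case: (eqVneq i 0) => [->|i0]; first by rewrite mulr1.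
  rewrite mulr0; apply/eqP; apply: contra_notT vd => vi; by exists i.
pose Q y := (v *m gram y *m v^T) 0 0.
pose L e := Q (unitv C e).
have QE y : Q y = \sum_e L e * y e.
  rewrite /Q gram_sum mulmx_sumr mulmx_suml summxE.
  by apply: eq_bigr => e _; rewrite -scalemxAr -scalemxAl mxE mulrC.
have : forall e, L e = 0.
  apply: span => y dir; rewrite -QE /Q.
  rewrite (rank_line_kernel (gram_sym x) rk _ vG) ?mxE // => t.
  by rewrite -gram_lin; apply/Mdn_gramP; apply: dir.
move=> L0; have := QE (meas (indicator [set i])); rewrite /Q.
rewrite big1 => [|e _]; last by rewrite L0 mul0r.
have -> : gram (meas (indicator [set i])) = delta_mx i i.
  apply/matrixP=> a b; rewrite gram_meas big_ord1 mxE /indicator !inE.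
  by rewrite [0 == i]eq_sym (negPf i0) !subr0 -natrM mulnb.
rewrite -(mul_delta_mx (0 : 'I_1)) mulmxA -colE -mulmxA -rowE mxE big_ord1 !mxE.
by move/eqP; rewrite mulf_eq0 orbb (negPf vi).
Qed.
End Gram.

(** * Descent from dimension [d] to dimension 1 *)

Section ScaledPermutation.
Variables (C : numClosedFieldType) (n : nat).
Variables (delta : edge n.+1 -> C) (pi : {perm edge n.+1}).
Hypothesis delta_neq0 : forall e, delta e != 0.

Definition scaled_perm (x : evec C n.+1) : evec C n.+1 :=
  fun e => delta e * x ((pi^-1)%g e).

Definition preserves d := forall x, Mdn d x -> Mdn d (scaled_perm x).

(** The map is linear, so it carries directions at [x] to directions at the image. A functional
    killing the latter pulls back to one killing the former, which is zero by [Mdn_spanning]; hence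
    the image is spanning too. *)
Lemma preserves_pred k : (k.+1 < n)%N -> preserves k.+1 -> preserves k.
Proof.
move=> kn pres x Mx; apply: spanning_Mdn => //.
  apply/pres/Mdn_gramP; move/Mdn_gramP: Mx; lia.
move=> L L0 e.
suff /(_ ((pi^-1)%g e)) : forall f, L (pi f) * delta (pi f) = 0.
  by rewrite permKV => /eqP; rewrite mulf_eq0 (negPf (delta_neq0 e)) orbF => /eqP.
apply: (Mdn_spanning Mx) => y dir.
rewrite -[RHS](L0 (scaled_perm y)); last first.
  move=> t; rewrite (_ : (fun _ => _) = scaled_perm (fun e => x e + t * y e)).
    exact/pres/dir.
  by apply: funext => f; rewrite /scaled_perm; ring.
rewrite [RHS](reindex_inj (@perm_inj _ pi)) /=.
by apply: eq_bigr => f _; rewrite /scaled_perm permK mulrA.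
Qed.

Lemma preserves1 k : (k.+1 < n)%N -> preserves k.+1 -> preserves 1.
Proof.
elim: k => // k IHk kn pres; apply: IHk; first exact: ltnW.
exact: preserves_pred.
Qed.
End ScaledPermutation.

(** * Stars of vertices as supports of one-dimensional measurements *)

Section Stars.
Variables (n : nat).
Implicit Types (u v w : 'I_n.+1) (e f : edge n.+1).

Definition star v : {set edge n.+1} := [set e : edge n.+1 | v \in val e].

Lemma edge_star v e : v \in val e -> exists2 u, u != v & val e = [set v; u].
Proof.
have [i [j [ij ->]]] := edgeP e; rewrite !inE => /orP[] /eqP->.
  by exists j; rewrite // eq_sym.
by exists i; rewrite // setUC.
Qed.

Lemma card_star v : #|star v| = n.
Proof.
rewrite -(card_imset _ val_inj).
have -> : [set val e | e in star v] = [set [set v; u] | u in [set~ v]].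
  apply/setP=> A; apply/imsetP/imsetP=> [[e]|[u]]; rewrite !inE.
    by case/edge_star=> u uv eE ->; exists u; rewrite ?inE.
  rewrite eq_sym => uv ->; have [e eE] := edge_exists uv.
  by exists e; rewrite // inE eE !inE eqxx.
rewrite card_in_imset ?cardsC1 ?card_ord // => u u'; rewrite !inE => uv _ /setP/(_ u).
by rewrite !inE eqxx orbT (negPf uv) => /esym/eqP.
Qed.

Lemma third_vertex u v : (1 < n)%N -> exists w, (w != u) && (w != v).
Proof.
move=> n1; have /set0Pn[w] : ~: [set u; v] != set0.
  by rewrite -card_gt0 cardsCs setCK card_ord cards2; case: (u != v) => /=; lia.
by rewrite !inE negb_or; exists w.
Qed.

Variable C : numClosedFieldType.

Lemma meas1_neq0 (q : config C 1 n.+1) e i j : i != j -> val e = [set i; j] ->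
  (meas q e != 0) = (q i 0 != q j 0).
Proof.
by move=> ij eE; rewrite (meas_edge _ ij eE) big_ord1 sqrf_eq0 subr_eq0.
Qed.

(* A support contains a cut [B, ~: B], of size [a (n + 1 - a)] for [a = #|B|];
   this exceeds [n] unless one side of the cut is a single vertex. *)
Lemma small_support_star (q : config C 1 n.+1) :
  [set e : edge n.+1 | meas q e != 0] != set0 -> (#|[set e : edge n.+1 | meas q e != 0%R]| <= n)%N ->
  exists w, [set e : edge n.+1 | meas q e != 0] = star w.
Proof.
set S := [set e | _] => /set0Pn[e0 Se0] leSn.
have [i [j [ij e0E]]] := edgeP e0.
move: Se0; rewrite inE (meas1_neq0 _ ij e0E) => qij.
pose B := [set u | q u 0 == q i 0].
have Bi : i \in B by rewrite inE.
have Bj : j \in ~: B by rewrite !inE eq_sym.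
have cutS u v : u \in B -> v \in ~: B -> q u 0 != q v 0.
  by rewrite !inE => /eqP->; rewrite eq_sym.
have cut_neq u v : u \in B -> v \in ~: B -> u != v.
  by move=> Bu Bv; apply: contra_neq (cutS _ _ Bu Bv) => ->.
have cut_le : (#|B| * #|~: B| <= n)%N.
  apply: leq_trans leSn; rewrite -cardsX -(card_imset S val_inj).
  rewrite -(@card_in_imset _ _ (fun p => [set p.1; p.2])); last first.
    move=> [u v] [u' v'] /setXP[/= Bu Bv] /setXP[/= Bu' Bv'] /setP E.
    have := E u; have := E v; rewrite !inE !eqxx orbT /=.
    rewrite (negPf (cut_neq _ _ Bu Bv')) orbF eq_sym (negPf (cut_neq _ _ Bu' Bv)) /=.
    by move=> /esym/eqP-> /esym/eqP->.
  apply/subset_leq_card/subsetP=> A /imsetP[[u v] /setXP[/= Bu Bv] ->].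
  have [e eE] := edge_exists (cut_neq _ _ Bu Bv); rewrite -eE imset_f // inE.
  by rewrite (meas1_neq0 _ (cut_neq _ _ Bu Bv) eE) cutS.
have cardB : (0 < #|B|)%N by rewrite card_gt0; apply/set0Pn; exists i.
have cardB' : (0 < #|~: B|)%N by rewrite card_gt0; apply/set0Pn; exists j.
have cardBB := cardsC B; rewrite card_ord in cardBB.
have [w isol] : exists w, forall u, u != w -> q u 0 != q w 0.
  (* With [a + b = n + 1] and [a b <= n], the product [(a - 1) (b - 1)] is 0. *)
  have /orP[|] : (#|B| == 1) || (#|~: B| == 1) by nia.
    move=> /cards1P[w Bw]; exists w => u uw.
    by rewrite eq_sym cutS // ?Bw ?inE // Bw inE.
  move=> /cards1P[w Bw]; exists w => u uw; apply: cutS; last by rewrite Bw inE.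
  by rewrite -[B]setCK Bw !inE.
(* The star of [w] lies in the support and already has [n] edges. *)
exists w; apply/esym/eqP; rewrite eqEcard card_star leSn andbT.
apply/subsetP=> e; rewrite !inE => /edge_star[u uw eE].
by rewrite (@meas1_neq0 _ _ w u) // 1?eq_sym // isol.
Qed.

Variables (delta : edge n.+1 -> C) (pi : {perm edge n.+1}).
Hypothesis delta_neq0 : forall e, delta e != 0.
Hypothesis pres : preserves delta pi 1.
Hypothesis n_gt1 : (1 < n)%N.

(** The image of the indicator of [v] is [meas q] for some [q] on a line. Its support, the image of
    [star v], has [n] edges and so is a star; on it [delta] agrees with [meas q]. *)
Lemma star_image v : exists w,
  (forall e, (w \in val (pi e)) = (v \in val e)) /\
  {in star w &, forall e f, delta e = delta f}.
Proof.
have [|q qE] := pres (x := meas (indicator C [set v])); first by eexists.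
have qE' e : meas q e = delta e * (v \in val ((pi^-1)%g e))%:R.
  by rewrite -qE /scaled_perm meas_indicator1.
have suppE : [set e : edge n.+1 | meas q e != 0] = pi @: star v.
  apply/setP=> e; rewrite -[e](permKV pi) mem_imset; last exact: perm_inj.
  rewrite !inE qE' permK mulf_eq0 negb_or delta_neq0 /=.
  by case: (v \in _); rewrite ?oner_eq0 ?eqxx.
have cardS : #|pi @: star v| = n by rewrite card_imset ?card_star //; exact: perm_inj.
have [||w Sw] := small_support_star (q := q).
- by rewrite suppE -card_gt0 cardS ltnW.
- by rewrite suppE cardS.
exists w; split=> [e|e f we wf].
  have : (pi e \in pi @: star v) = (pi e \in star w) by rewrite -suppE Sw.
  by rewrite mem_imset ?inE //; exact: perm_inj.
have deltaE g : g \in star w -> delta g = meas q g.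
  rewrite -Sw inE qE' => /eqP; case: (v \in _); rewrite ?mulr1 // mulr0.
  by move=> /eqP; rewrite eqxx.
rewrite !deltaE //; move: we wf; rewrite !inE.
case/edge_star=> a aw eE /edge_star[b bw fE].
rewrite (meas_edge _ _ eE) 1?eq_sym // (meas_edge _ _ fE) 1?eq_sym // !big_ord1.
(* The edge [{a,b}] avoids [w], so it is outside the support and [q] agrees at [a] and [b]. *)
have [->//|ab] := eqVneq a b.
have [g gE] := edge_exists ab.
have /negbT : (g \in star w) = false.
  by rewrite inE gE !inE ![w == _]eq_sym (negPf aw) (negPf bw).
by rewrite -Sw inE (meas1_neq0 _ ab gE) negbK => /eqP->.
Qed.

(** The relabeling sends [v] to the centre of the image of [star v]. It is injective because an edge
    from [u] to a third vertex separates [star u] from [star v]. *)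
Lemma scaled_perm_relabeling :
  (exists sigma : {perm 'I_n.+1}, forall e,
     val (pi e) = [set sigma x | x in val e]) /\
  (exists c, forall e, delta e = c).
Proof.
have [s sP] := fin_all_exists star_image.
have s_inj : injective s.
  move=> u v suv; apply/eqP/negPn/negP => uv.
  have [w /andP[wu wv]] := third_vertex u v n_gt1.
  rewrite eq_sym in wu; have [e eE] := edge_exists wu.
  have := (sP u).1 e; rewrite suv (sP v).1 eE !inE eqxx /=.
  by rewrite eq_sym (negPf uv) eq_sym (negPf wv).
split.
  exists (perm s_inj) => e; have [i [j [ij eE]]] := edgeP e.
  apply/esym/eqP; rewrite eqEcard card_imset; last exact: perm_inj.
  rewrite (eqP (valP e)) (eqP (valP (pi e))) leqnn andbT.
  by apply/subsetP=> _ /imsetP[x xe ->]; rewrite permE (sP x).1.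
(* By surjectivity of the relabeling, every star is one on which [delta] is constant. *)
have const a : {in star a &, forall e f, delta e = delta f}.
  by rewrite -[a](permKV (perm s_inj)) permE; case: (sP ((perm s_inj)^-1%g a)).
have [w /andP[w0 _]] := third_vertex 0 0 n_gt1.
have [e0 e0E] := edge_exists w0.
exists (delta e0) => e; have [i [j [ij eE]]] := edgeP e.
have [wi|wi] := eqVneq w i.
  by apply: (const w); rewrite inE ?eE ?e0E !inE ?wi eqxx.
(* The edge [{w,i}] lies in both stars and links [delta e] to [delta e0]. *)
have [g gE] := edge_exists wi.
transitivity (delta g); [apply: (const i)|apply: (const w)];
  by rewrite inE ?eE ?e0E ?gE !inE eqxx ?orbT.
Qed.
End Stars.

Theorem theorem3p10 (R : realType) (d n : nat) :
  (1 <= d)%N -> (d + 2 <= n)%N ->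
  forall (delta : edge n -> R[i]) (pi : {perm edge n}),
    (forall e, delta e != 0) ->
    lin_auto d (mmul (diagm delta) (permm (R[i]) pi)) ->
    (exists sigma : {perm 'I_n},
        forall f : edge n, exists g : edge n,
          val g = [set sigma x | x in val f] /\
          mapply (permm (R[i]) pi) (unitv (R[i]) f) = unitv (R[i]) g) /\
    (exists c : R[i], diagm delta = (fun e f => c * midm (R[i]) e f)).
Proof.
case: d n => [//|d] [|n] // _ dn delta pi delta_neq0 [_ [pres _]].
have presd : preserves delta pi d.+1.
  move=> x /pres; congr Mdn; apply: funext => e.
  have entry f : mmul (diagm delta) (permm R[i] pi) e f =
      delta e * (e == pi f)%:R.
    rewrite /mmul /diagm (bigD1 e) //= eqxx big1 ?addr0 // => g /negPf.
    by rewrite eq_sym => ->; rewrite mul0r.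
  (* Row [e] of the matrix has its only nonzero entry in column [pi^-1 e]. *)
  rewrite /mapply (bigD1 ((pi^-1)%g e)) //= entry permKV eqxx mulr1.
  rewrite big1 ?addr0 // => f fe; rewrite entry.
  case: (eqVneq e (pi f)) fe => [->|_ _]; first by rewrite permK eqxx.
  by rewrite mulr0 mul0r.
have dn' : (d.+1 < n)%N by lia.
have n_gt1 : (1 < n)%N by lia.
have [[sigma sE] [c cE]] :=
  scaled_perm_relabeling delta_neq0 (preserves1 delta_neq0 dn' presd) n_gt1.
split.
  exists sigma => f; exists (pi f); split=> //; apply: funext => e.
  rewrite /mapply /permm /unitv (bigD1 f) //= eqxx mulr1 big1 ?addr0 // => g.
  by move=> /negPf->; rewrite mulr0.
exists c; apply: funext => e; apply: funext => f; rewrite /diagm /midm cE.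
by case: eqVneq; rewrite ?mulr1 ?mulr0.
Qed.
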